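(* For $N\ge 1$, let $\nu(N)$ denote the number of inequivalent success/failure sequences of length $N$ containing at least one success, i.e. $$\nu(N)\equiv\sum_{r=1}^{N}\ \sum_{M=1}^{\min(r,\,N-r+1)}\mathrm{Part}(r,M).$$ Then $$\nu(N)=\mathrm{Part}(N+1)-1.$$
   Context: $\mathrm{Part}(n)$ denotes the number of partitions of the integer $n$ into a sum of one or more positive integers (order of summands irrelevant), with $\mathrm{Part}(0)=1$. $\mathrm{Part}(n,k)$ denotes the number of partitions of $n$ into exactly $k$ positive integers. For a sequence $\xi$ of $N$ successes/failures, a success run is a maximal block of consecutive successes, and $\mathbf n(\xi)=(n_1,\dots,n_N)$ where $n_l$ is the number of success runs of length exactly $l$. Two sequences $\xi_1,\xi_2$ of length $N$ are equivalent if $\mathbf n(\xi_1)=\mathbf n(\xi_2)$. In the sum, $r$ is the number of successes and $M$ the number of success runs. *)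

(* Defs.v *)
From mathcomp Require Import all_boot.

Set Implicit Arguments.
Unset Strict Implicit.
Unset Printing Implicit Defensive.

Definition is_partition (n : nat) (s : seq nat) : bool :=
  [&& sorted geq s, 0 \notin s & sumn s == n].

(* The next lemma shows that bounding the number of parts by n, and each part  *)
(* by n, loses no partition of n: the types {bseq n of 'I_n.+1} below only     *)
(* serve to make the set of partitions finite.                                 *)
Lemma is_partition_bounded n s :
  is_partition n s -> exists t : n.-bseq 'I_n.+1, s = map val t.
Proof.
case/and3P=> _ s_gt0 /eqP sum_s.
have le_size : size s <= n.
  rewrite -{}sum_s; elim: s s_gt0 => //= x s IHs.
  rewrite inE negb_or eq_sym -lt0n => /andP[x_gt0 /IHs le_s].
  by rewrite -add1n leq_add.
have le_n x : x \in s -> x < n.+1.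
  rewrite ltnS -{}sum_s; elim: s {s_gt0 le_size} => //= y s IHs.
  by rewrite inE => /predU1P[->|/IHs/leq_trans->//]; rewrite ?leq_addr ?leq_addl.
have size_t : size (map (@inord n) s) <= n by rewrite size_map.
exists (Bseq size_t); rewrite /= -map_comp -[LHS]map_id.
by apply/eq_in_map => x /le_n x_lt /=; rewrite inordK.
Qed.

Definition Part (n : nat) : nat :=
  #|[set s : n.-bseq 'I_n.+1 | is_partition n (map val s)]|.

Definition Part_into (n k : nat) : nat :=
  #|[set s : n.-bseq 'I_n.+1 | is_partition n (map val s) & size s == k]|.

(* In xi : N.-tuple bool, true stands for a success. *)

Definition success_block (N : nat) (xi : N.-tuple bool) (A : {set 'I_N}) : bool :=
  [&& A != set0, [forall i in A, tnth xi i]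
    & [forall i in A, forall j in A, forall k : 'I_N,
         (i <= k <= j) ==> (k \in A)]].

Definition success_run (N : nat) (xi : N.-tuple bool) (A : {set 'I_N}) : bool :=
  maxset (success_block xi) A.

Definition num_runs (N : nat) (xi : N.-tuple bool) (l : nat) : nat :=
  #|[set A : {set 'I_N} | success_run xi A & #|A| == l]|.

(* (n_1, ..., n_N); the ordinal l carries the component of index l + 1. *)
Definition run_vector (N : nat) (xi : N.-tuple bool) : N.-tuple nat :=
  [tuple num_runs xi l.+1 | l < N].

Definition run_equiv (N : nat) : rel (N.-tuple bool) :=
  [rel xi1 xi2 | run_vector xi1 == run_vector xi2].

Definition nu (N : nat) : nat :=
  #|equivalence_partition (@run_equiv N) [set xi : N.-tuple bool | true \in xi]|.

(* Main.v *)
Require Import Defs.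
From mathcomp Require Import all_boot zify.

(** Append one more failure to a sequence of length N and cut it after every
    failure.  Each block is then a possibly empty success run followed by one
    failure, so the block lengths form a composition of N + 1, and every
    composition of N + 1 arises in this way.  A run of length l > 0 is exactly a
    block of length l + 1, so two sequences are equivalent when their block
    lengths agree on all values above 1; since both compositions have the same
    sum, the number of blocks of length 1 then agrees too ([run_equivE]).
    Equivalence classes are therefore compositions of N + 1 up to order, that
    is, partitions of N + 1.  A sequence without any success corresponds to the
    partition 1 + ... + 1, which is the only one to be discarded; hence
    nu N = Part (N + 1) - 1 ([nu_count_partitions], [count_large_partitions]).

    For the double sum, subtract 1 from every part of such a partition of N + 1
    and drop the zeros.  What remains is a partition of some r into M positive
    parts with r + M <= N + 1, and it determines the original partition: add 1
    to each part and fill up with ones ([count_pad_partitions]).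

    The main work is to identify the success runs, defined as maximal blocks
    among sets of positions, with the blocks of this recursive decomposition;
    a run is determined by its first position ([success_runE]), and counting
    first positions is a recursion on the sequence ([count_run_starts]). *)

(** * Cutting a sequence after each failure *)

Fixpoint block_lengths (s : seq bool) : seq nat :=
  if s is b :: s' then
    let c := block_lengths s' in
    if b then (head 0 c).+1 :: behead c else 1 :: c
  else [:: 1].

Lemma head_block_lengths s : head 0 (block_lengths s) = (index false s).+1.
Proof. by elim: s => //= -[] s //= ->. Qed.

Lemma block_lengths_cons s :
  block_lengths s = (index false s).+1 :: behead (block_lengths s).
Proof. by rewrite -head_block_lengths; case: s => // -[]. Qed.

Lemma block_lengths_gt0 s : 0 \notin block_lengths s.
Proof.
elim: s => //= b s IHs; case: b => /=; rewrite inE //=.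
by apply: contra IHs => /mem_behead.
Qed.

Lemma sumn_block_lengths s : sumn (block_lengths s) = (size s).+1.
Proof.
elim: s => //= b s; case: b => /= [|->] //.
by rewrite [block_lengths s]block_lengths_cons /= => <-.
Qed.

Lemma has_block_lengths s : has (ltn 1) (block_lengths s) = (true \in s).
Proof.
elim: s => //= -[] s IHs /=; rewrite inE //=.
by rewrite head_block_lengths.
Qed.

(** A part b stands for b - 1 successes and one failure, the failure of the last
    part being the appended one. *)
Lemma block_lengths_surj c :
  c != [::] -> 0 \notin c -> exists s, block_lengths s = c.
Proof.
elim: c => // b c IHc _; rewrite inE negb_or => /andP[b_gt0 c_gt0].
have [s Ds] : exists s, block_lengths s = 1 :: c.
  have [->|/IHc/(_ c_gt0)[s <-]] := eqVneq c [::]; first by exists [::].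
  by exists (false :: s).
exists (nseq b.-1 true ++ s); case: b b_gt0 => // b _ /=.
by elim: b => //= b ->.
Qed.

(** Successes at the head of [s] form the start of a run only when [prev], the
    symbol standing before [s], is a failure; when it is a success, the first
    block of [s] continues an earlier run and must not be counted again.  This
    generality over [prev] is what makes the induction go through. *)
Lemma count_run_starts prev s l : 0 < l ->
  count (fun i => ~~ nth false (prev :: s) i && (index false (drop i s) == l))
        (iota 0 (size s)) =
  count_mem l.+1 (if prev then behead (block_lengths s) else block_lengths s).
Proof.
move=> l_gt0; elim: s prev => [|b s IHs] prev.
  by case: prev => //=; case: l l_gt0.
rewrite -[size (b :: s)]/(1 + size s) iotaD count_cat (iotaDl 1 0) count_map.
rewrite [X in _ + X]IHs /= addn0.
by case: b; case: prev; rewrite //= head_block_lengths eqSS.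
Qed.

(** Past the end of the sequence, the default value of [nth] plays the role of
    the appended failure. *)
Lemma nth_index_drop s i : nth false s (i + index false (drop i s)) = false.
Proof.
rewrite -nth_drop; case: (boolP (false \in drop i s)) => [/nth_index -> //|].
by move/memNindex->; rewrite nth_default.
Qed.

Lemma lt_run_endP {s i j} : i <= j ->
  (j < i + index false (drop i s)) <-> (forall k, i <= k <= j -> nth false s k).
Proof.
move=> le_ij; split=> [lt_j k /andP[le_ik le_kj]|run_ij].
  have: k - i < index false (drop i s) by lia.
  by move/(before_find false); rewrite nth_drop subnKC //= eqbF_neg => /negbFE.
rewrite ltnNge; apply/negP => le_j.
have := run_ij (i + index false (drop i s)).
by rewrite nth_index_drop leq_addr le_j => /(_ isT).
Qed.

(** * Success runs as maximal blocks of positions *)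

Section Runs.
Variables (N : nat) (xi : N.-tuple bool).

Definition run_from (i : 'I_N) : {set 'I_N} :=
  [set j : 'I_N | i <= j < i + index false (drop i xi)].

Definition run_starts : {set 'I_N} :=
  [set i : 'I_N | ~~ nth false (false :: xi) i && nth false xi i].

Lemma card_run_from i : #|run_from i| = index false (drop i xi).
Proof.
have le_end : index false (drop i xi) <= N - i.
  by rewrite (leq_trans (index_size _ _)) // size_drop size_tuple.
rewrite -sum1_card; under eq_bigl do rewrite inE.
rewrite -(big_mkord (fun j => i <= j < i + _) (fun=> 1)) sum1_count.
case: i (index _ _) le_end => i /= lt_iN l le_end.
have -> : N = i + (l + (N - i - l)) by lia.
rewrite /index_iota subn0 !iotaD !count_cat.
(* Only the middle one of three consecutive intervals contributes. *)
have count_out m k : m + k <= i \/ i + l <= m ->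
    count (fun j => i <= j < i + l) (iota m k) = 0.
  move=> out; apply/eqP; rewrite -leqn0 leqNgt -has_count.
  by apply/hasPn=> j; rewrite mem_iota; lia.
rewrite [count _ (iota 0 i)]count_out; last by left.
rewrite [count _ (iota (0 + i + l) _)]count_out; last by right.
rewrite addn0 add0n -[RHS](size_iota i); apply/eqP; rewrite -all_count.
by apply/allP=> j; rewrite mem_iota.
Qed.

Lemma success_blockP {A : {set 'I_N}} : reflect
  [/\ A != set0, forall i : 'I_N, i \in A -> nth false xi i
    & forall i j k : 'I_N, i \in A -> j \in A -> i <= k <= j -> k \in A]
  (success_block xi A).
Proof.
apply: (iffP and3P) => [[A_n0 + +] | [A_n0 A_true A_conv]].
  move=> /forall_inP A_true /forall_inP A_conv; split=> //.
    by move=> i /A_true; rewrite (tnth_nth false).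
  by move=> i j k /A_conv/forall_inP Ai /Ai/forallP/(_ k)/implyP.
split=> //; first by apply/forall_inP=> i /A_true; rewrite (tnth_nth false).
apply/forall_inP=> i Ai; apply/forall_inP=> j Aj; apply/forallP=> k.
by apply/implyP; apply: A_conv.
Qed.

Lemma mem_run_from {i j : 'I_N} :
  j \in run_from i <-> i <= j /\ (forall k, i <= k <= j -> nth false xi k).
Proof.
rewrite inE; split=> [/andP[le_ij]|[le_ij]]; first by move/(lt_run_endP le_ij).
by move/(lt_run_endP le_ij) ->; rewrite le_ij.
Qed.

(** From any position [a] of the block, go back as long as there are successes:
    convexity keeps the whole block to the right of the position reached. *)
Lemma success_block_sub_run {A : {set 'I_N}} {a} :
  success_block xi A -> a \in A ->
  exists2 i, i \in run_starts & A \subset run_from i.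
Proof.
case/success_blockP=> _ A_true A_conv Aa.
(* P i: there is no failure from i up to a; the least such i starts the run. *)
pose P i := (i <= a) && all (nth false xi) (iota i (a.+1 - i)).
have true_between i k : P i -> i <= k <= a -> nth false xi k.
  by case/andP=> _ /allP Pi le_k; apply: Pi; rewrite mem_iota; lia.
have exP : exists i, P i.
  exists a; rewrite /P leqnn subSnn /= andbT; exact: A_true.
case: (ex_minnP exP) => i Pi min_i.
have le_ia : i <= a by case/andP: Pi.
have lt_iN : i < N by apply: leq_ltn_trans (ltn_ord a).
exists (Ordinal lt_iN).
  rewrite inE /= (true_between _ _ Pi) ?leqnn // andbT.
  case: i Pi min_i le_ia {lt_iN} => // i Pi min_i le_ia /=; apply/negP=> xi_i.
  suff /min_i : P i by rewrite ltnn.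
  rewrite /P ltnW //=; apply/allP=> k; rewrite mem_iota => le_k.
  have [->//|ne_ki] := eqVneq k i; apply: true_between Pi _; lia.
apply/subsetP=> j Aj; apply/mem_run_from => /=; split.
  have [le_aj|lt_ja] := leqP a j; first exact: leq_trans le_aj.
  apply: min_i; rewrite /P ltnW //=; apply/allP=> k; rewrite mem_iota => le_k.
  have lt_kN : k < N by have := ltn_ord a; lia.
  by apply: A_true (Ordinal lt_kN) _; apply: (A_conv j a) => //=; lia.
move=> k le_k; have [le_ka|lt_ak] := leqP k a.
  by apply: true_between Pi _; lia.
have lt_kN : k < N by have := ltn_ord j; lia.
by apply: A_true (Ordinal lt_kN) _; apply: (A_conv a j) => //=; lia.
Qed.

Lemma run_from_block {i : 'I_N} : i \in run_starts -> success_block xi (run_from i).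
Proof.
rewrite inE => /andP[_ xi_i]; apply/success_blockP; split.
- apply/set0Pn; exists i; apply/mem_run_from; split=> // k le_k.
  by have -> : k = i by lia.
- by move=> j /mem_run_from[le_ij ->] //; rewrite le_ij leqnn.
- by move=> j k m; rewrite !inE; lia.
Qed.

(** A position that starts a run is preceded by a failure, so it cannot lie
    strictly inside another run. *)
Lemma run_from_inj : {in run_starts &, forall i j : 'I_N,
  run_from i \subset run_from j -> i = j}.
Proof.
move=> i j start_i start_j /subsetP sub_ij.
have i_in : i \in run_from i.
  move: start_i; rewrite inE => /andP[_ xi_i]; apply/mem_run_from; split=> // k le_k.
  by have -> : k = i by lia.
have /mem_run_from[le_ji true_ji] := sub_ij i i_in.
apply/val_inj/eqP; rewrite eqn_leq le_ji andbT leqNgt /=; apply/negP=> lt_ji.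
move: start_i; rewrite inE => /andP[/negP[]].
case: (i : nat) lt_ji true_ji => // k lt_jk true_jk; apply: (true_jk k); lia.
Qed.

Lemma success_runE (A : {set 'I_N})  :
  success_run xi A = (A \in run_from @: run_starts).
Proof.
apply/maxsetP/imsetP => [[block_A max_A]|[i start_i ->]].
  have [/set0Pn[a Aa] _ _] := success_blockP block_A.
  have [i start_i sub_A] := success_block_sub_run block_A Aa.
  by exists i => //; rewrite (max_A _ (run_from_block start_i)).
split=> [|B block_B sub_iB]; first exact: run_from_block.
have [/set0Pn[b Bb] _ _] := success_blockP block_B.
have [j start_j sub_Bj] := success_block_sub_run block_B Bb.
have eq_ij := run_from_inj _ _ start_i start_j (subset_trans sub_iB sub_Bj).
by apply/eqP; rewrite eqEsubset sub_iB {1}eq_ij sub_Bj.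
Qed.

(** Runs, their first positions and the blocks of length at least 2 correspond
    one to one. *)
Lemma num_runsE l : 0 < l -> num_runs xi l = count_mem l.+1 (block_lengths xi).
Proof.
move=> l_gt0; rewrite -(count_run_starts false) // size_tuple.
have -> : num_runs xi l = #|[set i in run_starts | index false (drop i xi) == l]|.
  rewrite -(card_in_imset (f := run_from)); last first.
    move=> i j /setIdP[start_i _] /setIdP[start_j _] eq_ij.
    by apply: run_from_inj; rewrite ?eq_ij.
  apply: eq_card => A; rewrite inE success_runE; apply/andP/imsetP.
    case=> /imsetP[i start_i ->]; rewrite card_run_from => eq_l.
    by exists i; rewrite // inE start_i.
  case=> i /setIdP[start_i eq_l] ->; rewrite card_run_from eq_l.
  by split=> //; apply: imset_f.
rewrite -sum1_card -sum1_count; under eq_bigl do rewrite !inE.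
rewrite -(big_mkord (fun i => ~~ nth false (false :: xi) i && nth false xi i
   && (index false (drop i xi) == l)) (fun=> 1)).
rewrite /index_iota subn0; apply: eq_bigl => i; rewrite -andbA; congr (_ && _).
have [eq_l|] := eqVneq; rewrite ?andbF // andbT.
by apply: (lt_run_endP (leqnn i)).1; rewrite ?leqnn // eq_l; lia.
Qed.

End Runs.

(** * Equivalent sequences have the same multiset of block lengths *)

Lemma leq_sumn (s : seq nat) x : x \in s -> x <= sumn s.
Proof.
by elim: s => //= y s IHs; rewrite inE => /predU1P[->|/IHs]; lia.
Qed.

Lemma sumn_count1 s : 0 \notin s ->
  sumn s = count_mem 1 s + sumn [seq x <- s | 1 < x].
Proof.
elim: s => //= x s IHs; rewrite inE negb_or => /andP[x_gt0 /IHs ->].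
by case: x x_gt0 => [|[|x]] //= _; lia.
Qed.

(** The sum recovers the multiplicity of the part 1, about which the run
    numbers say nothing. *)
Lemma perm_eq_large_parts s t : 0 \notin s -> 0 \notin t -> sumn s = sumn t ->
  {in [pred l | 1 < l <= sumn s], forall l, count_mem l s = count_mem l t} ->
  perm_eq s t.
Proof.
move=> s_gt0 t_gt0 eq_sum eq_cnt.
have eq_large l : 1 < l -> count_mem l s = count_mem l t.
  move=> l_gt1; have [le_l|lt_l] := leqP l (sumn s).
    by apply: eq_cnt; rewrite inE l_gt1.
  have count0 u : sumn u < l -> count_mem l u = 0.
    by move=> lt_u; apply/count_memPn/negP=> /leq_sumn; rewrite leqNgt lt_u.
  by rewrite !count0 // -eq_sum.
have perm_large : perm_eq [seq x <- s | 1 < x] [seq x <- t | 1 < x].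
  apply/allP=> l _; apply/eqP; rewrite !count_filter.
  have [l_gt1|l_le1] := ltnP 1 l.
    have eq_l : predI (pred1 l) (ltn 1) =1 pred1 l.
      by move=> x /=; case: eqP => // ->; rewrite l_gt1.
    by rewrite !(eq_count eq_l); apply: eq_large.
  have eq0 : predI (pred1 l) (ltn 1) =1 pred0.
    by move=> x /=; case: eqP => // ->; rewrite ltnNge l_le1.
  by rewrite !(eq_count eq0) !count_pred0.
apply/allP=> l _; apply/eqP; case: l => [|[|l]].
- by rewrite (count_memPn s_gt0) (count_memPn t_gt0).
- apply: (@addIn (sumn [seq x <- s | 1 < x])).
  by rewrite -(sumn_count1 _ s_gt0) (perm_sumn perm_large) -(sumn_count1 _ t_gt0).
exact: eq_large.
Qed.

Lemma run_equivE (N : nat) (xi1 xi2 : N.-tuple bool) :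
  run_equiv xi1 xi2 = perm_eq (block_lengths xi1) (block_lengths xi2).
Proof.
apply/eqP/idP => [eq_runs|/permP eq_blocks]; last first.
  by apply: eq_from_tnth => l; rewrite !tnth_mktuple !num_runsE.
have sum_blocks (xi : N.-tuple bool) : sumn (block_lengths xi) = N.+1.
  by rewrite sumn_block_lengths size_tuple.
apply: perm_eq_large_parts; rewrite ?block_lengths_gt0 ?sum_blocks // => -[|[|l]] //.
rewrite inE /= ltnS => lt_lN; rewrite -!num_runsE //.
by have := congr1 (fun v => tnth v (Ordinal lt_lN)) eq_runs; rewrite !tnth_mktuple.
Qed.

(** * Equivalence classes and partitions *)

(** Listing partitions as plain sequences lets partitions of different integers
    be compared; the bounded sequences that define [Part] have a type that
    depends on the integer. *)
Definition partitions (n : nat) : seq (seq nat) :=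
  [seq map val s | s : n.-bseq 'I_n.+1
     <- enum [set s : n.-bseq 'I_n.+1 | is_partition n (map val s)]].

Lemma map_val_bseq_inj n :
  injective (fun s : n.-bseq 'I_n.+1 => map val (s : seq 'I_n.+1)).
Proof. by move=> s t /(inj_map val_inj)/val_inj. Qed.

Lemma partitions_uniq n : uniq (partitions n).
Proof. by rewrite map_inj_uniq ?enum_uniq //; apply: map_val_bseq_inj. Qed.

Lemma mem_partitions n s : (s \in partitions n) = is_partition n s.
Proof.
apply/mapP/idP => [[t]|part_s]; first by rewrite mem_enum inE => part_t ->.
have [t Ds] := is_partition_bounded part_s.
by exists t; rewrite // mem_enum inE -Ds.
Qed.

Lemma size_partitions n : size (partitions n) = Part n.
Proof. by rewrite size_map -cardE. Qed.

Lemma count_partitions n (a : pred (seq nat)) :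
  #|[set s : n.-bseq 'I_n.+1 | is_partition n (map val s) & a (map val s)]| =
  count a (partitions n).
Proof.
rewrite cardE -(size_map (fun s : n.-bseq 'I_n.+1 => map val (s : seq 'I_n.+1))).
rewrite -size_filter.
apply/perm_size/uniq_perm.
- by rewrite map_inj_uniq ?enum_uniq //; apply: map_val_bseq_inj.
- by rewrite filter_uniq ?partitions_uniq.
move=> s; rewrite mem_filter mem_partitions; apply/mapP/andP => [[t]|[a_s part_s]].
  by rewrite mem_enum inE => /andP[part_t a_t] ->.
have [t Ds] := is_partition_bounded part_s.
by exists t; rewrite // mem_enum inE -Ds part_s.
Qed.

(** The class attached to a partition consists of the sequences whose block
    lengths are a rearrangement of it.  There is a success exactly when some
    block has length at least 2. *)
Lemma nu_count_partitions N : nu N = count (has (ltn 1)) (partitions N.+1).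
Proof.
rewrite -count_partitions.
set parts := [set s | _ & _]; set D := [set xi : N.-tuple bool | true \in xi].
pose cls (t : N.+1.-bseq 'I_N.+2) :=
  [set xi in D | perm_eq (block_lengths xi) (map val t)].
have parts_of_blocks (xi : N.-tuple bool) : xi \in D ->
    exists2 t, t \in parts & perm_eq (block_lengths xi) (map val t).
  rewrite inE => xi_D; pose s := sort geq (block_lengths xi).
  have perm_s : perm_eq s (block_lengths xi) by rewrite perm_sort.
  have part_s : is_partition N.+1 s.
    apply/and3P; split; first by apply: sort_sorted => x y; apply: leq_total.
      by rewrite mem_sort block_lengths_gt0.
    by rewrite (perm_sumn perm_s) sumn_block_lengths size_tuple.
  have [t Ds] := is_partition_bounded part_s.
  exists t; last by rewrite -Ds perm_sym.
  by rewrite inE -Ds part_s (perm_has _ perm_s) has_block_lengths.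
have blocks_of_parts t : t \in parts -> exists2 xi : N.-tuple bool,
    xi \in D & block_lengths xi = map val t.
  rewrite inE => /andP[/and3P[_ t_gt0 /eqP sum_t] has_t].
  have [|s Ds] := block_lengths_surj (map val t) _ t_gt0.
    by case: (map _ _) has_t.
  have size_s : size s == N by rewrite -eqSS -sumn_block_lengths Ds sum_t.
  by exists (Tuple size_s); rewrite // inE /= -has_block_lengths Ds.
have cls_inj : {in parts &, injective cls}.
  move=> t u t_part u_part eq_cls; have [xi xi_D Dxi] := blocks_of_parts t t_part.
  have : xi \in cls u by rewrite -eq_cls inE xi_D Dxi perm_refl.
  rewrite inE xi_D Dxi => perm_tu.
  apply: (@map_val_bseq_inj N.+1); apply: (sorted_eq (leT := geq)) perm_tu.
  - by move=> x y z /= le_xy le_zx; apply: leq_trans le_xy.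
  - by move=> x y; rewrite andbC -eqn_leq => /eqP.
  - by move: t_part; rewrite inE => /andP[/and3P[]].
  - by move: u_part; rewrite inE => /andP[/and3P[]].
have cls_eq (xi : N.-tuple bool) (t : N.+1.-bseq _) :
    perm_eq (block_lengths xi) (map val t) ->
    [set xi' in D | run_equiv xi xi'] = cls t.
  move=> /permPl perm_xi; apply/setP=> xi'; rewrite !inE run_equivE perm_xi.
  by rewrite perm_sym.
rewrite -(card_in_imset cls_inj) /nu /equivalence_partition.
apply: eq_card => X; apply/imsetP/imsetP => [[xi xi_D ->]|[t t_part ->]].
  have [t t_part perm_t] := parts_of_blocks xi xi_D.
  by exists t; rewrite // (cls_eq xi t).
have [xi xi_D Dxi] := blocks_of_parts t t_part.
by exists xi; rewrite // (cls_eq xi t) // Dxi perm_refl.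
Qed.

Lemma no_large_part s : 0 \notin s -> ~~ has (ltn 1) s -> s = nseq (sumn s) 1.
Proof.
elim: s => //= x s IHs; rewrite inE !negb_or => /andP[x_gt0 /IHs IH].
case/andP=> x_le1 /IH Ds.
by case: x x_gt0 x_le1 => [|[|]] //= _ _; rewrite -Ds.
Qed.

(** The partition into ones is the only one without a part above 1. *)
Lemma count_large_partitions n : count (has (ltn 1)) (partitions n) = Part n - 1.
Proof.
rewrite -size_partitions -(count_predC (has (ltn 1))).
suff -> : count (predC (has (ltn 1))) (partitions n) = 1 by rewrite addnK.
have ones_part : is_partition n (nseq n 1).
  apply/and3P; split; last by rewrite sumn_nseq mul1n.
    by case: n => //= n; elim: n => //= n ->.
  by rewrite mem_nseq andbF.
(* Duplicate-freeness makes the count of a listed partition equal to 1. *)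
rewrite -[RHS]/(true : nat) -ones_part -mem_partitions.
rewrite -count_uniq_mem ?partitions_uniq //.
apply: eq_in_count => s; rewrite mem_partitions => /and3P[_ s_gt0 /eqP sum_s] /=.
apply/idP/eqP => [/(no_large_part _ s_gt0)|->]; first by rewrite sum_s.
by rewrite has_nseq /= andbF.
Qed.

(** * Partitions by number of successes and number of runs *)

(** The two inverse maps between partitions of [n] with a part above 1 and
    partitions of smaller integers [r] into [M > 0] parts with [r + M <= n]:
    parts of [n] are block lengths, parts of [r] are run lengths. *)
Definition pad_parts (n : nat) (s : seq nat) : seq nat :=
  map S s ++ nseq (n - (sumn s + size s)) 1.

Definition reduce_parts (s : seq nat) : seq nat := [seq x.-1 | x <- s & 1 < x].

Lemma pad_partsK n s : 0 \notin s -> reduce_parts (pad_parts n s) = s.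
Proof.
move=> s_gt0; rewrite /reduce_parts filter_cat map_cat.
rewrite [X in _ ++ X](_ : _ = [::]) ?cats0; last by elim: (n - _).
rewrite filter_map /= -map_comp /=.
rewrite (eq_in_filter (a2 := predT)) ?filter_predT ?map_id // => x x_s /=.
by rewrite ltnS lt0n; apply: contraNneq s_gt0 => <-.
Qed.

Lemma sumn_map_S s : sumn (map S s) = sumn s + size s.
Proof. by elim: s => //= x s ->; lia. Qed.

Lemma pad_parts_partition n s : is_partition (sumn s) s -> sumn s + size s <= n ->
  is_partition n (pad_parts n s).
Proof.
case/and3P=> sorted_s s_gt0 _ le_n; apply/and3P; split.
- have geq_trans : transitive geq by move=> x y z /= ? ?; lia.
  rewrite sorted_pairwise // pairwise_cat -!sorted_pairwise //; apply/and3P; split.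
  + by apply/allrelP=> x y /mapP[z _ ->]; rewrite mem_nseq => /andP[_ /eqP->].
  + by rewrite sorted_map.
  by elim: (n - _) => //= -[|k] //= ->.
- rewrite mem_cat mem_nseq andbF orbF; apply/negP; by case/mapP.
by rewrite sumn_cat sumn_map_S sumn_nseq mul1n subnKC.
Qed.

Lemma reduce_parts_partition s : sorted geq s ->
  is_partition (sumn (reduce_parts s)) (reduce_parts s).
Proof.
move=> sorted_s; apply/and3P; split=> //.
  have geq_trans : transitive geq by move=> x y z /= ? ?; lia.
  rewrite sorted_map; apply: sub_sorted (sorted_filter geq_trans _ sorted_s).
  by move=> x y /=; lia.
by apply/negP=> /mapP[x]; rewrite mem_filter; lia.
Qed.

Lemma reduce_partsK s : sorted geq s -> 0 \notin s ->
  pad_parts (sumn s) (reduce_parts s) = s.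
Proof.
elim: s => //= x s IHs path_s; rewrite inE negb_or => /andP[x_gt0 s_gt0].
have {IHs} IH := IHs (path_sorted path_s) s_gt0.
rewrite /reduce_parts /=; have [x_gt1|x_le1] := ltnP 1 x; rewrite /pad_parts /=.
  rewrite prednK ?(ltnW x_gt1) //; congr (_ :: _); rewrite -[RHS]IH /pad_parts.
  congr (_ ++ nseq _ _); rewrite -/(reduce_parts s); lia.
have s_le1 : ~~ has (ltn 1) s.
  have geq_trans : transitive geq by move=> y z t /= ? ?; lia.
  apply/hasPn=> y y_s; move: path_s; rewrite path_sortedE // => /andP[+ _].
  move/allP/(_ y y_s) => /= le_yx.
  by rewrite -leqNgt (leq_trans le_yx).
have -> : [seq y <- s | 1 < y] = [::].
  by apply/eqP; rewrite -size_eq0 size_filter -leqn0 leqNgt -has_count.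
by rewrite /= subn0 [in RHS](no_large_part s) //; have -> : x = 1 by lia.
Qed.

Lemma size_partition_bounds {r s} : 0 < r -> is_partition r s -> 0 < size s <= r.
Proof.
move=> r_gt0 /and3P[_ s_gt0 /eqP sum_s]; apply/andP; split.
  by case: s sum_s r_gt0 {s_gt0} => //= <-.
rewrite -{}sum_s {r_gt0}; elim: s s_gt0 => //= x s IHs.
by rewrite inE negb_or => /andP[x_gt0 /IHs]; lia.
Qed.

(** A partition of [r] has at most [r] parts, so only the bound [K] matters. *)
Lemma sum_Part_into r K : 0 < r ->
  \sum_(1 <= M < (minn r K).+1) Part_into r M =
  count (fun s => size s <= K) (partitions r).
Proof.
move=> r_gt0; transitivity (\sum_(1 <= M < (minn r K).+1)
    \sum_(s <- partitions r) if size s == M then 1 else 0).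
  apply: eq_bigr => M _; rewrite -big_mkcond sum1_count -count_partitions.
  by apply: eq_card => s; rewrite !inE size_map.
rewrite exchange_big -sum1_count [RHS]big_mkcond; apply: eq_big_seq => s.
rewrite mem_partitions => /(size_partition_bounds r_gt0)/andP[s_gt0 s_le].
rewrite -big_mkcond (eq_bigl (pred1 (size s))); last by move=> M; rewrite eq_sym.
rewrite sum1_count count_uniq_mem ?iota_uniq //.
rewrite mem_index_iota s_gt0 ltnS leq_min s_le.
by case: leqP.
Qed.

(** The bound [size s <= N - r + 1] is what leaves room for [pad_parts] to fill
    up to [N + 1]. *)
Lemma count_pad_partitions N :
  count (has (ltn 1)) (partitions N.+1) =
  \sum_(1 <= r < N.+1) count (fun s => size s <= N - r + 1) (partitions r).
Proof.
pose L := [seq pad_parts N.+1 s | r <- iota 1 N,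
            s <- [seq s <- partitions r | size s <= N - r + 1]].
transitivity (size L); last first.
  rewrite size_allpairs_dep sumnE big_map /index_iota subn1 /=.
  by apply: eq_bigr => r _; rewrite size_filter.
rewrite -size_filter; apply/perm_size/uniq_perm.
- by rewrite filter_uniq ?partitions_uniq.
- apply: allpairs_uniq_dep => [||p q]; first exact: iota_uniq.
    by move=> r _; rewrite filter_uniq ?partitions_uniq.
  have part_of (u : {r : nat & seq nat}) :
      u \in [seq @Tagged _ r (fun=> seq nat) s | r <- iota 1 N,
            s <- [seq s <- partitions r | size s <= N - r + 1]] ->
      is_partition (tag u) (tagged u).
    by case/allpairsPdep=> r [s [_ + ->]]; rewrite mem_filter mem_partitions => /andP[].
  case: p q => [r s] [r' s'] /part_of/and3P[/= _ s_gt0 /eqP <-].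
  case/part_of/and3P=> [/= _ s'_gt0 /eqP <-].
  by move/(congr1 reduce_parts); rewrite !pad_partsK // => ->.
move=> c; rewrite mem_filter mem_partitions; apply/andP/allpairsPdep.
  case=> has_c /and3P[sorted_c c_gt0 /eqP sum_c].
  have part_s := reduce_parts_partition _ sorted_c.
  pose s := reduce_parts c; rewrite -/s in part_s.
  have Dc : pad_parts N.+1 s = c by rewrite -sum_c; apply: reduce_partsK.
  have le_sum : sumn s + size s <= N.+1.
    by rewrite -sum_c -Dc /pad_parts sumn_cat sumn_map_S leq_addr.
  have size_s : 0 < size s by rewrite size_map size_filter -has_count.
  have sum_s : 0 < sumn s.
    case/and3P: part_s size_s => _ + _; case: (s) => //= x u.
    by rewrite inE negb_or; lia.
  exists (sumn s), s; split; last by rewrite Dc.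
    by rewrite mem_iota; lia.
  by rewrite mem_filter mem_partitions part_s andbT; lia.
case=> r [s [+ + ->]]; rewrite mem_iota mem_filter mem_partitions.
move=> le_r /andP[size_s part_s]; have [_ s_gt0 /eqP sum_s] := and3P part_s.
rewrite pad_parts_partition ?sum_s //; last by lia.
have r_gt0 : 0 < r by lia.
have /andP[+ _] := size_partition_bounds r_gt0 part_s.
rewrite /pad_parts has_cat has_map; case: s s_gt0 {size_s part_s sum_s} => //= x s.
by rewrite inE negb_or => /andP[x_gt0 _] _; rewrite ltnS lt0n eq_sym x_gt0.
Qed.

Theorem proposition1 (N : nat) (hN : 1 <= N) :
  nu N = \sum_(1 <= r < N.+1)
           \sum_(1 <= M < (minn r (N - r + 1)).+1) Part_into r M
  /\ nu N = Part (N + 1) - 1.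
Proof.
split; last by rewrite nu_count_partitions count_large_partitions addn1.
rewrite nu_count_partitions count_pad_partitions; apply: eq_big_nat => r /andP[r_gt0 _].
by rewrite sum_Part_into.
Qed.
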